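(* Let $m=6+12q$ with $q=2+4d$ for a nonnegative integer $d$, and let $t=t(q)$. The minimal decomposition of $\mathbb{Z}_2$ for the Fibonacci polynomial $F_m$ is $$\mathbb{Z}_2=\{0\}\sqcup\Bigl(\bigcup_{n\ge 1}\bigcup_{k=0}^{2^{t+1}-1}M_{n,k}\Bigr)\sqcup(1+2\mathbb{Z}_2),$$ where $M_{n,k}=\bigl((1+4k)2^n+2^{n+t+3}\mathbb{Z}_2\bigr)\cup\bigl((2^{t+2}-1-4k)2^n+2^{n+t+3}\mathbb{Z}_2\bigr)$. Here $\{0\}$ is the set of a fixed point, the $M_{n,k}$'s are the minimal components, and the clopen set $1+2\mathbb{Z}_2$ is the attracting basin of $\{0\}$ and the $M_{n,k}$'s.
   Context: $\mathbb{Z}_2$ is the ring of 2-adic integers with the 2-adic metric. The Fibonacci polynomials are defined by $F_0(x)=0$, $F_1(x)=1$, $F_m(x)=xF_{m-1}(x)+F_{m-2}(x)$ for $m\ge 2$. For a nonnegative integer $q$ with binary expansion $q=\sum_{i\ge 0}c_i2^i$, $c_i\in\{0,1\}$ (with $c_i=0$ for all large $i$), define $t(q)=\min\{i\ge 0: c_i=c_{i+1}\}$. For a polynomial $f$ over $\mathbb{Z}_2$, a minimal decomposition of $\mathbb{Z}_2$ for $f$ is a decomposition $\mathbb{Z}_2=\mathcal P\sqcup\mathcal M\sqcup\mathcal B$ (some parts possibly empty) in which: $\mathcal P$ is the finite set consisting of all periodic points of $f$; $\mathcal M=\bigsqcup_i\mathcal M_i$ is the union of all (at most countably many) clopen $f$-invariant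 sets $\mathcal M_i$ (the minimal components), each a finite union of balls, such that each $f:\mathcal M_i\to\mathcal M_i$ is minimal (every orbit is dense in $\mathcal M_i$); and each point of $\mathcal B$ lies in the attracting basin of a periodic orbit or of a minimal subsystem. A point $x$ lies in the attracting basin of a set $C$ (a periodic orbit or minimal component) if the distance from $f^n(x)$ to $C$ tends to $0$ as $n\to\infty$; when a part $\mathcal B$ of a decomposition is said to be the attracting basin of several such sets, this means every point of $\mathcal B$ lies in the attracting basin of one of them. *)

(* Defs.v *)
From HB Require Import structures.
From mathcomp Require Import all_boot all_order all_algebra.
From mathcomp Require Import all_classical all_reals all_analysis.

Set Implicit Arguments.
Unset Strict Implicit.
Unset Printing Implicit Defensive.

Import Order.TTheory GRing.Theory Num.Theory.
Local Open Scope ring_scope.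
Local Open Scope classical_set_scope.

(* The ring of 2-adic integers, as the inverse limit of the rings Z/2^n:      *)
(* res x n is the residue of x modulo 2^n, in [0, 2^n[ (by res_compat).       *)
Record Z2 := MkZ2 {
  res : nat -> nat;
  res_compat : forall n, res n = (res n.+1 %% 2 ^ n)%N }.

HB.instance Definition _ := gen_eqMixin Z2.
HB.instance Definition _ := gen_choiceMixin Z2.

Lemma Z2_ext (x y : Z2) : res x =1 res y -> x = y.
Proof.
case: x => a Ha; case: y => b Hb /= eab.
have eab' : a = b by apply/funext.
by case: _ / eab' in Hb *; congr MkZ2; exact: Prop_irrelevance.
Qed.

Lemma res_mod (x : Z2) n : (res x n %% 2 ^ n)%N = res x n.
Proof. by rewrite [res x n]res_compat modn_mod. Qed.

Lemma modn_expS a n : (a %% 2 ^ n.+1 = a %[mod 2 ^ n])%N.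
Proof. by rewrite modn_dvdm // dvdn_exp2l. Qed.

Fact nat_compat (a n : nat) : (a %% 2 ^ n = (a %% 2 ^ n.+1) %% 2 ^ n)%N.
Proof. by rewrite modn_expS. Qed.
Definition Z2_of_nat (a : nat) : Z2 := MkZ2 (nat_compat a).

Fact add_compat (x y : Z2) n :
  ((res x n + res y n) %% 2 ^ n =
   ((res x n.+1 + res y n.+1) %% 2 ^ n.+1) %% 2 ^ n)%N.
Proof. by rewrite modn_expS -[RHS]modnDm -!res_compat. Qed.
Definition Z2_add (x y : Z2) : Z2 := MkZ2 (add_compat x y).

Fact mul_compat (x y : Z2) n :
  ((res x n * res y n) %% 2 ^ n =
   ((res x n.+1 * res y n.+1) %% 2 ^ n.+1) %% 2 ^ n)%N.
Proof. by rewrite modn_expS -[RHS]modnMm -!res_compat. Qed.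
Definition Z2_mul (x y : Z2) : Z2 := MkZ2 (mul_compat x y).

Lemma res_le (x : Z2) n : (res x n <= 2 ^ n)%N.
Proof. by rewrite -res_mod ltnW // ltn_mod expn_gt0. Qed.

Fact opp_compat (x : Z2) n :
  ((2 ^ n - res x n) %% 2 ^ n =
   ((2 ^ n.+1 - res x n.+1) %% 2 ^ n.+1) %% 2 ^ n)%N.
Proof.
rewrite modn_expS; apply/eqP.
rewrite -(eqn_modDr (res x n)) subnK ?res_le // modnn.
rewrite [X in (_ + X)%N]res_compat modnDmr subnK ?res_le //.
by rewrite expnS modnMl.
Qed.
Definition Z2_opp (x : Z2) : Z2 := MkZ2 (opp_compat x).

Fact Z2_addA : associative Z2_add.
Proof. by move=> x y z; apply: Z2_ext => n /=; rewrite modnDml modnDmr addnA. Qed.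

Fact Z2_addC : commutative Z2_add.
Proof. by move=> x y; apply: Z2_ext => n /=; rewrite addnC. Qed.

Fact Z2_add0 : left_id (Z2_of_nat 0) Z2_add.
Proof. by move=> x; apply: Z2_ext => n /=; rewrite mod0n add0n res_mod. Qed.

Fact Z2_addN : left_inverse (Z2_of_nat 0) Z2_opp Z2_add.
Proof.
move=> x; apply: Z2_ext => n /=.
by rewrite modnDml subnK ?res_le // modnn mod0n.
Qed.

HB.instance Definition _ :=
  GRing.isZmodule.Build Z2 Z2_addA Z2_addC Z2_add0 Z2_addN.

Fact Z2_mulA : associative Z2_mul.
Proof. by move=> x y z; apply: Z2_ext => n /=; rewrite modnMml modnMmr mulnA. Qed.

Fact Z2_mulC : commutative Z2_mul.
Proof. by move=> x y; apply: Z2_ext => n /=; rewrite mulnC. Qed.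

Fact Z2_mul1 : left_id (Z2_of_nat 1) Z2_mul.
Proof. by move=> x; apply: Z2_ext => n /=; rewrite modnMml mul1n res_mod. Qed.

Fact Z2_mulD : left_distributive Z2_mul +%R.
Proof.
move=> x y z; apply: Z2_ext => n /=.
by rewrite modnMml modnDm mulnDl.
Qed.

Fact Z2_one_neq0 : Z2_of_nat 1 != 0.
Proof. by apply/eqP => /(congr1 (fun x => res x 1)). Qed.

HB.instance Definition _ :=
  GRing.Zmodule_isComNzRing.Build Z2 Z2_mulA Z2_mulC Z2_mul1 Z2_mulD Z2_one_neq0.

Lemma res_natr (k n : nat) : res (k%:R : Z2) n = (k %% 2 ^ n)%N.
Proof.
elim: k => [|k IHk] //; rewrite -addn1 natrD.
by rewrite [LHS]/= -/(res (k%:R : Z2) n) IHk modnDm.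
Qed.

(* The 2-adic absolute value 2^-v, where v is the 2-adic valuation of x, i.e. *)
(* the least n such that 2^(n+1) does not divide x; it is 0 if x = 0.         *)
Definition abs2 (R : numFieldType) (x : Z2) : R :=
  match pselect (exists n, res x n.+1 != 0%N) with
  | left ex => 2%:R ^- ex_minn ex
  | right _ => 0
  end.

Definition dist2 (R : numFieldType) (x y : Z2) : R := abs2 R (x - y).

Lemma resD (x y : Z2) n : res (x + y) n = ((res x n + res y n) %% 2 ^ n)%N.
Proof. by []. Qed.

Lemma res0P (x : Z2) k n : (k <= n)%N -> res x n = 0%N -> res x k = 0%N.
Proof.
move=> /subnK <-; elim: (n - k)%N => [//|i IHi].
by rewrite addSn => h; apply: IHi; rewrite res_compat h mod0n.
Qed.

Lemma resB0 (x y : Z2) n : (res (x - y) n = 0%N) <-> (res x n = res y n).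
Proof.
split=> h; first by rewrite -[x](subrK y) resD h add0n res_mod.
by rewrite /= modnDmr h subnKC ?res_le // modnn.
Qed.

Lemma abs2_le (R : numFieldType) (x : Z2) n :
  (abs2 R x <= 2%:R ^- n) = (res x n == 0%N).
Proof.
have p2 k : 0 < (2%:R ^+ k : R) by rewrite exprn_gt0.
rewrite /abs2; case: pselect => [ex|nex]; last first.
  rewrite invr_ge0 ltW //; apply/esym/eqP.
  case: n => [|n]; first by rewrite res_compat expn0 modn1.
  by apply/eqP/negPn/negP => h; apply: nex; exists n.
case: ex_minnP => v hv vmin.
rewrite lef_pV2 ?posrE // ler_eXn2l ?ltr1n //.
apply/idP/eqP => [nv|h].
  case: n nv => [|n] nv; first by rewrite res_compat expn0 modn1.
  by apply/eqP/negPn/negP => /vmin; rewrite leqNgt nv.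
by rewrite leqNgt; apply/negP => vn; move: hv; rewrite (res0P vn h).
Qed.

Lemma abs2_ge0 (R : numFieldType) (x : Z2) : 0 <= abs2 R x.
Proof.
by rewrite /abs2; case: pselect => // ex; rewrite invr_ge0 exprn_ge0.
Qed.

Lemma abs2_cases (R : numFieldType) (x : Z2) :
  abs2 R x = 0 \/ exists n, abs2 R x = 2%:R ^- n.
Proof. by rewrite /abs2; case: pselect => ex; [right; eexists|left]. Qed.

Lemma abs2_eq0 (R : numFieldType) (x : Z2) : abs2 R x = 0 -> x = 0.
Proof.
move=> h; apply: Z2_ext => n.
have /eqP -> : res x n == 0%N by rewrite -(abs2_le R) h invr_ge0 exprn_ge0.
by rewrite /= mod0n.
Qed.

Lemma dist2_le (R : numFieldType) (x y : Z2) n :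
  (dist2 R x y <= 2%:R ^- n) = (res x n == res y n).
Proof.
by rewrite /dist2 abs2_le; apply/eqP/eqP => /resB0.
Qed.

Lemma dist2_sym (R : numFieldType) (x y : Z2) : dist2 R x y = dist2 R y x.
Proof.
have le u v : dist2 R u v <= dist2 R v u.
  have [h|[n h]] := abs2_cases R (v - u); rewrite [leRHS]/dist2 h; last first.
    by rewrite dist2_le eq_sym -(dist2_le R) /dist2 h.
  have /eqP := abs2_eq0 h; rewrite subr_eq0 => /eqP vu.
  by rewrite /dist2 vu subrr -h vu subrr.
by apply/eqP; rewrite eq_le !le.
Qed.

Lemma dist2_ultra (R : numFieldType) (y x z : Z2) :
  dist2 R x z <= dist2 R x y \/ dist2 R x z <= dist2 R y z.
Proof.
have [h|[n h]] := abs2_cases R (x - y).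
  have /eqP := abs2_eq0 h; rewrite subr_eq0 => /eqP ->; by right.
have [h'|[m h']] := abs2_cases R (y - z).
  have /eqP := abs2_eq0 h'; rewrite subr_eq0 => /eqP ->; by left.
have e1 : res x n = res y n by apply/eqP; rewrite -(dist2_le R) /dist2 h.
have e2 : res y m = res z m by apply/eqP; rewrite -(dist2_le R) /dist2 h'.
have le_res (u v : Z2) i j : (i <= j)%N -> res u j = res v j -> res u i = res v i.
  by move=> ij /resB0 uv; apply/resB0; exact: res0P uv.
rewrite [dist2 R x y]h [dist2 R y z]h' !dist2_le.
case: (leqP n m) => nm; [left|right]; apply/eqP.
  by rewrite e1; exact: le_res e2.
by rewrite -e2; exact: le_res (ltnW nm) e1.
Qed.

(* The uniform structure is introduced independently of the type R in which   *)
(* the distance takes its values, hence before the metric structures.         *)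
Definition Z2_entourage : set_system (Z2 * Z2) :=
  filter_from [set: nat] (fun n => [set xy | res xy.1 n = res xy.2 n]).

Lemma Z2_entourage_filter : Filter Z2_entourage.
Proof.
apply: filter_from_filter; first by exists 0%N.
move=> i j _ _; exists (maxn i j) => // -[x y] /= xy; split => /=.
  by apply/resB0; apply: (res0P (leq_maxl i j)); apply/resB0.
by apply/resB0; apply: (res0P (leq_maxr i j)); apply/resB0.
Qed.

Lemma Z2_entourage_diagonal (A : set (Z2 * Z2)) :
  Z2_entourage A -> diagonal `<=` A.
Proof. by move=> [n _ sub] xy dxy; apply: sub; rewrite /= dxy. Qed.

Lemma Z2_entourage_inv (A : set (Z2 * Z2)) :
  Z2_entourage A -> Z2_entourage (A^-1)%relation.
Proof. by move=> [n _ sub]; exists n => // -[x y] /= xy; exact: sub. Qed.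

Lemma Z2_entourage_split (A : set (Z2 * Z2)) :
  Z2_entourage A -> exists2 B, Z2_entourage B & (B \; B `<=` A)%relation.
Proof.
move=> [n _ sub]; exists [set xy | res xy.1 n = res xy.2 n]; first by exists n.
by move=> [x z] /= [y /= xy yz]; apply: sub; rewrite /= xy.
Qed.

HB.instance Definition _ := isUniform.Build Z2 Z2_entourage_filter
  Z2_entourage_diagonal Z2_entourage_inv Z2_entourage_split.

Section Z2Metric.
Variable R : realType.

Definition Z2_ball (x : Z2) (e : R) : set Z2 := [set y | dist2 R x y < e].

Lemma Z2_ball_center x (e : R) : 0 < e -> Z2_ball x e x.
Proof.
move=> e0; rewrite /Z2_ball /=; apply: le_lt_trans e0.
rewrite /dist2 subrr /abs2; case: pselect => // ex; exfalso.
by case: ex => n /=; rewrite mod0n.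
Qed.

Lemma Z2_ball_sym x y (e : R) : Z2_ball x e y -> Z2_ball y e x.
Proof. by rewrite /Z2_ball /= dist2_sym. Qed.

Lemma Z2_ball_triangle x y z (e1 e2 : R) :
  Z2_ball x e1 y -> Z2_ball y e2 z -> Z2_ball x (e1 + e2) z.
Proof.
rewrite /Z2_ball /= => xy yz.
have p1 : 0 < e1 by exact: le_lt_trans (abs2_ge0 _ _) xy.
have p2 : 0 < e2 by exact: le_lt_trans (abs2_ge0 _ _) yz.
have [h|h] := dist2_ultra R y x z.
  by rewrite (le_lt_trans h) // (lt_trans xy) // ltrDl.
by rewrite (le_lt_trans h) // (lt_trans yz) // ltrDr.
Qed.

Lemma Z2_entourageE : entourage = entourage_ Z2_ball.
Proof.
rewrite predeqE => A; split.
  move=> [n _ sub]; exists (2%:R ^- n); first by rewrite /= invr_gt0 exprn_gt0.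
  by move=> [x y] /= /ltW; rewrite dist2_le => /eqP xy; exact: sub.
move=> [e /= e0 sub].
have [n ne] : exists n, (2%:R ^- n : R) < e.
  exists (Num.truncn e^-1).+1; rewrite invf_plt ?posrE ?exprn_gt0 //.
  have h := truncnS_gt e^-1; apply: lt_trans h _.
  by rewrite -natrX ltr_nat ltn_expl.
exists n => // -[x y] /= xy; apply: sub => /=; apply: le_lt_trans ne.
by rewrite dist2_le xy.
Qed.

HB.instance Definition _ := @Uniform_isPseudoMetric.Build R Z2
  Z2_ball Z2_ball_center Z2_ball_sym Z2_ball_triangle Z2_entourageE.

Lemma dist2_eq0 (x y : Z2) : dist2 R x y = 0 -> x = y.
Proof. by move=> /abs2_eq0 /eqP; rewrite subr_eq0 => /eqP. Qed.

Lemma Z2_ballE (x : Z2) (d : R) : ball x d = [set y | dist2 R x y < d].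
Proof. by []. Qed.

HB.instance Definition _ := @PseudoMetric_isMetric.Build R Z2
  (@dist2 R) (fun x y => abs2_ge0 R (x - y)) dist2_eq0 Z2_ballE.

End Z2Metric.

Section Dynamics.
Variables (R : realType) (X : metricType R).
Implicit Types (f : X -> X) (x : X) (C P B : set X).

Definition orbit f x : set X := [set iter n f x | n in [set: nat]].

Definition periodic_point f x := exists2 n, (0 < n)%N & iter n f x = x.

Definition finite_union_of_balls C :=
  exists2 s : seq (X * R), all (fun b => 0 < b.2) s &
    C = [set x | exists2 b, b \in s & ball b.1 b.2 x].

Definition minimal_on f C := forall x, C x -> C `<=` closure (orbit f x).

Definition minimal_component f C :=
  [/\ C !=set0, clopen C, finite_union_of_balls C, f @` C `<=` C &
      minimal_on f C].

Definition attracting_basin f C : set X :=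
  [set x | edist_inf C (iter n f x) @[n --> \oo] --> 0%E].

(* X is the disjoint union of P, of the M i for i in D, and of B. *)
Definition minimal_decomposition f P (I : Type) (D : set I) (M : I -> set X) B :=
  [/\ [/\ P `|` \bigcup_(i in D) M i `|` B = [set: X],
          P `&` \bigcup_(i in D) M i = set0,
          P `&` B = set0 &
          \bigcup_(i in D) M i `&` B = set0],
      finite_set P /\ P = [set x | periodic_point f x],
      [/\ countable D, trivIset D M &
          [set M i | i in D] = [set C | minimal_component f C]] &
      forall x, B x ->
        (exists2 p, P p & attracting_basin f (orbit f p) x) \/
        (exists2 i, D i & attracting_basin f (M i) x)].

End Dynamics.

Fixpoint fibonacci_poly (A : nzRingType) (m : nat) : {poly A} :=
  match m with
  | 0%N => 0
  | m1.+1 => match m1 with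
             | 0%N => 1
             | m2.+1 => 'X * fibonacci_poly A m1 + fibonacci_poly A m2
             end
  end.

Definition binary_digit (q i : nat) : nat := (q %/ 2 ^ i %% 2)%N.

Lemma exists_equal_digits q :
  exists i, binary_digit q i == binary_digit q i.+1.
Proof.
have h i : (q <= i)%N -> binary_digit q i = 0%N.
  move=> qi; rewrite /binary_digit divn_small ?mod0n //.
  exact: leq_ltn_trans qi (ltn_expl _ _).
by exists q; rewrite !h.
Qed.

(* t(q) = min {i | c_i = c_(i+1)}, where q = sum_i c_i 2^i *)
Definition first_equal_digits (q : nat) : nat := ex_minn (exists_equal_digits q).

(* a + 2^n Z_2 *)
Definition Z2_coset (a : Z2) (n : nat) : set Z2 :=
  [set a + 2%:R ^+ n * z | z in [set: Z2]].

(* M_(n,k), where t = t(q) *)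
Definition fib_component (t n k : nat) : set Z2 :=
  Z2_coset ((1 + 4%:R * k%:R) * 2%:R ^+ n) (n + t + 3) `|`
  Z2_coset ((2%:R ^+ (t + 2) - 1 - 4%:R * k%:R) * 2%:R ^+ n) (n + t + 3).

(* Main.v *)
Require Import Defs.
From mathcomp Require Import all_boot all_order all_algebra.
From mathcomp Require Import all_classical all_reals all_analysis.
From mathcomp Require Import ring zify.

Import Order.TTheory GRing.Theory Num.Theory.
Local Open Scope ring_scope.
Local Open Scope classical_set_scope.

(** Write F = F_m, m = 2l with l = 3 + 6q, and s = t + 2.

    The idea is that F is very close to x |-> -x on the even numbers.  Since F
    is an odd function, F o F = G o G for G(x) = - F(x), and G is close to the
    identity in two precise senses ([almost_negation_sphere]):
    - its difference quotients at even points are 1 mod 4, because those of F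
      are l mod 4 ([fib_diff_even]) and l = -1 mod 4;
    - it moves each point of valuation n by a number of valuation exactly
      n + s.  Indeed F_{2l}(x) + x = (F_l(x) + F_{l-2}(x)) F_{l+1}(x)
      ([fib_double_addX]), where the first factor is twice an odd number
      ([fib_lucas_even]), while iterating F_{2k} = F_k (F_{k+1} + F_{k-1})
      shows that F_{l+1}(x) has the valuation of (l + 1) x / 2
      ([fib_pow2_index]); and l + 1 = 2 (2 + 3q) has valuation exactly t + 2
      ([first_equal_digits_valuation]), as -2/3 = ...1010 in base 2, so that
      the length of the alternating part of q measures how close q is to -2/3.

    A map H with quotients 1 mod 4 which moves every point by exactly 2^r
    satisfies H(H x) - x = (H x - x)(2 + 4c), hence H o H has the same property
    with r + 1 in place of r.  So the 2^j-th iterate of H moves points by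
    exactly 2^(r+j), and adjusting one binary digit after another shows that
    every orbit is dense in its ball of radius 2^-r ([displaced_dense]) and that
    no point is periodic ([displaced_aperiodic]).  Applied to H = F o F with
    r = n + s + 1 this gives density in each of the two balls of M_{n,k}, which
    F exchanges since F(x) = 2^(n+s) - x mod 2^(n+s+1)
    ([almost_negation_reflect]).

    Counting residues, the M_{n,k} partition the nonzero even numbers.  As 3
    divides m, F maps odd numbers to even ones, so an odd point falls into {0}
    or into some M_{n,k} after one step. *)

(** * Fibonacci polynomials at even and odd points *)

Definition fib {A : comNzRingType} (m : nat) (x : A) : A :=
  (fibonacci_poly A m).[x].

Lemma fib0 {A : comNzRingType} (x : A) : fib 0 x = 0.
Proof. by rewrite /fib /= horner0. Qed.

Lemma fib1 {A : comNzRingType} (x : A) : fib 1 x = 1.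
Proof. by rewrite /fib /= hornerE. Qed.

Lemma fibSS {A : comNzRingType} m (x : A) :
  fib m.+2 x = x * fib m.+1 x + fib m x.
Proof. by rewrite /fib [fibonacci_poly A m.+2]/= hornerD hornerM hornerX. Qed.

Lemma fib_add {A : comNzRingType} a b (x : A) :
  fib (a + b).+1 x = fib a.+1 x * fib b.+1 x + fib a x * fib b x.
Proof.
elim: a b => [|a IHa] b; first by rewrite add0n fib1 fib0 mul1r mul0r addr0.
by rewrite addSnnS IHa !fibSS; ring.
Qed.

Lemma fib_double {A : comNzRingType} k (x : A) :
  fib k.+1.*2 x = fib k.+1 x * (fib k.+2 x + fib k x).
Proof. by rewrite -addnn addnS fib_add; ring. Qed.

(** An instance of Vajda's identity, used to factor F_{2l} + X below. *)
Lemma fib_vajda {A : comNzRingType} k (x : A) :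
  fib k x * fib k.+3 x - fib k.+1 x * fib k.+2 x = - (-1) ^+ k * x.
Proof.
elim: k => [|k IHk].
  by rewrite !fibSS fib1 fib0 expr0; ring.
have -> : - (-1) ^+ k.+1 * x = - (- (-1) ^+ k * x) by rewrite exprS; ring.
by rewrite -IHk !fibSS; ring.
Qed.

(** With F_{-2} = - X this is F_{a+b} - F_{a-b} = L_a F_b for a = k + 1 and
    b = k + 3, where L_a = F_{a+1} + F_{a-1}: the sum F_m + X is a product whose
    2-adic valuation can be read off exactly. *)
Lemma fib_double_addX {A : comNzRingType} k (x : A) : odd k ->
  fib k.+2.*2 x + x = fib k.+3 x * (fib k.+2 x + fib k x).
Proof.
move=> ok; rewrite fib_double.
have := fib_vajda k x; rewrite -signr_odd ok expr1 opprK mul1r => h.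
by rewrite -[X in _ + X]h; ring.
Qed.

Lemma fib_oppX {A : comNzRingType} m (x : A) :
  fib m (- x) = (-1) ^+ m.+1 * fib m x.
Proof.
suff: fib m (- x) = (-1) ^+ m.+1 * fib m x /\
      fib m.+1 (- x) = (-1) ^+ m.+2 * fib m.+1 x by case.
elim: m => [|m [IHm IHm1]].
  by rewrite !fib0 !fib1 mulr0 expr2 mulrNN !mulr1.
by split=> //; rewrite !fibSS IHm IHm1 ![(-1) ^+ _.+1]exprS; ring.
Qed.

Lemma fib_even_arg {A : comNzRingType} l (u : A) :
  (exists c, fib l.*2 (2 * u) = 2 * c) /\
  (exists c, fib l.*2.+1 (2 * u) = 1 + 4 * c).
Proof.
elim: l => [|l [[c hc] [e he]]].
  by rewrite fib0 fib1; split; exists 0; rewrite mulr0 ?addr0.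
rewrite doubleS !fibSS he hc; split.
  by exists (u * (1 + 4 * e) + c); ring.
by exists (u * (u * (1 + 4 * e) + c) + e); ring.
Qed.

(** Only the linear term l X of F_{2l} matters modulo 4: this polynomial is odd,
    and (x^j - y^j) / (x - y) is a multiple of 4 for even x, y and j >= 3.  The
    proof avoids coefficients by carrying F_{2l+1} along, whose difference
    quotient is only even. *)
Lemma fib_diff_even {A : comNzRingType} l (u v : A) :
  (exists c, fib l.*2 (2 * u) - fib l.*2 (2 * v) =
             (2 * u - 2 * v) * (l%:R + 4 * c)) /\
  (exists c, fib l.*2.+1 (2 * u) - fib l.*2.+1 (2 * v) =
             (2 * u - 2 * v) * (2 * c)).
Proof.
elim: l => [|l [[c hc] [e he]]].
  by rewrite !fib0 !fib1 !subrr; split; exists 0; rewrite !mulr0 ?addr0 ?mulr0.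
have [[a ha] [b hb]] := fib_even_arg l v.
have [[a' ha'] _] := fib_even_arg l.+1 v.
have [c' hc'] : exists c', fib l.+1.*2 (2 * u) - fib l.+1.*2 (2 * v) =
    (2 * u - 2 * v) * (l.+1%:R + 4 * c').
  exists (u * e + b + c); rewrite doubleS !fibSS -addn1 natrD.
  transitivity (2 * u * (fib l.*2.+1 (2 * u) - fib l.*2.+1 (2 * v))
    + (2 * u - 2 * v) * fib l.*2.+1 (2 * v)
    + (fib l.*2 (2 * u) - fib l.*2 (2 * v))); first by ring.
  by rewrite hc he hb; ring.
split; first by exists c'.
exists (u * (l.+1%:R + 4 * c') + a' + e).
rewrite doubleS !(fibSS l.*2.+1) -doubleS.
transitivity (2 * u * (fib l.+1.*2 (2 * u) - fib l.+1.*2 (2 * v))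
    + (2 * u - 2 * v) * fib l.+1.*2 (2 * v)
    + (fib l.*2.+1 (2 * u) - fib l.*2.+1 (2 * v))); first by ring.
by rewrite hc' he ha'; ring.
Qed.

(** The Lucas value L_{2l+2} is 2 mod 4 at even points, so that doubling an
    even index multiplies the Fibonacci value by exactly one factor 2. *)
Lemma fib_lucas_even {A : comNzRingType} l (u : A) :
  exists c, fib l.*2.+3 (2 * u) + fib l.*2.+1 (2 * u) = 2 * (1 + 2 * c).
Proof.
have [_ [a ha]] := fib_even_arg l u; have [_ [b hb]] := fib_even_arg l.+1 u.
by exists (a + b); rewrite ha -doubleS hb; ring.
Qed.

Lemma fib_double_at0 {A : comNzRingType} l : fib l.*2 (0 : A) = 0.
Proof. by elim: l => [|l IHl]; rewrite ?fib0 // doubleS fibSS mul0r add0r. Qed.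

(** Repeated doubling, from index 2l, where the value at an even point is the
    point times a number congruent to l mod 4. *)
Lemma fib_pow2_index {A : comNzRingType} j l (u : A) : odd l ->
  exists c, fib (2 ^ j.+1 * l) (2 * u) = 2 * u * (2 ^+ j * (1 + 2 * c)).
Proof.
move=> ol; elim: j => [|j [c hc]].
  have [[c]] := fib_diff_even l u 0; rewrite expn1 mul2n mulr0 fib_double_at0.
  rewrite !subr0 => -> _; exists (l./2%:R + 2 * c).
  rewrite -{1}[l]odd_double_half ol natrD -mul2n natrM expr0 /=; ring.
have [k hk] : exists k, (2 ^ j.+1 * l)%N = k.*2.+2.
  have l0 : (0 < l)%N by case: l ol {hc}.
  exists (2 ^ j * l).-1; have := expn_gt0 2 j; rewrite expnS; nia.
have [b hb] := fib_lucas_even k u.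
exists (b + c + 2 * b * c).
rewrite expnS -mulnA hk mul2n fib_double hb -hk hc exprS; ring.
Qed.

Lemma fib_odd_arg {A : comNzRingType} k (u : A) :
  (exists c, fib (3 * k) (1 + 2 * u) = 2 * c) /\
  (exists c, fib (3 * k).+1 (1 + 2 * u) = 1 + 2 * c).
Proof.
elim: k => [|k [[a ha] [b hb]]].
  by rewrite muln0 fib0 fib1; split; exists 0; rewrite mulr0 ?addr0.
pose c := (1 + 2 * u + 2 * u ^+ 2) * (1 + 2 * b) + a * (1 + 2 * u).
rewrite mulnS !fibSS hb ha; split; first by exists c; rewrite /c; ring.
by exists ((1 + 2 * u) * c + b + u + 2 * u * b + a); rewrite /c; ring.
Qed.

(** * Divisibility by powers of two in the 2-adic integers *)

Lemma cosetP a n x : Z2_coset a n x <-> exists z, x = a + 2 ^+ n * z.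
Proof. by split=> [[z _ <-]|[z ->]]; [exists z|exists z]. Qed.

Lemma res_le_eq (x y : Z2) i j :
  (i <= j)%N -> res x j = res y j -> res x i = res y i.
Proof. by move=> ij /resB0 h; apply/resB0; exact: res0P h. Qed.

Lemma res_natX n : res (2 ^+ n : Z2) n = 0%N.
Proof. by rewrite -natrX res_natr modnn. Qed.

Lemma res_modle (x : Z2) i j : (i <= j)%N -> res x i = (res x j %% 2 ^ i)%N.
Proof.
move=> /subnK <-; elim: (j - i)%N => [|k IHk]; first by rewrite res_mod.
by rewrite IHk [res x (k + i)]res_compat addSn modn_dvdm // dvdn_exp2l ?leq_addl.
Qed.

(** The quotient by 2^n is obtained by shifting the sequence of residues. *)
Lemma res0_dvd (x : Z2) n : res x n = 0%N -> exists z, x = 2 ^+ n * z.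
Proof.
move=> x0.
have shift_compat k :
    (res x (k + n) %/ 2 ^ n = (res x (k.+1 + n) %/ 2 ^ n) %% 2 ^ k)%N.
  rewrite [res x (k + n)]res_compat addSn expnD.
  by rewrite modn_divl.
exists (MkZ2 shift_compat); apply: Z2_ext => k; rewrite -natrX.
have -> : res ((2 ^ n)%N%:R * MkZ2 shift_compat) k =
   ((res ((2 ^ n)%N%:R) k * (res x (k + n) %/ 2 ^ n)) %% 2 ^ k)%N by [].
rewrite res_natr modnMml mulnC divnK; first by rewrite -res_modle ?leq_addr.
by rewrite /dvdn -res_modle ?x0 ?leq_addl.
Qed.

Lemma coset_res a n x : Z2_coset a n x <-> res x n = res a n.
Proof.
rewrite cosetP; split=> [[z ->]|/resB0 /res0_dvd [z hz]]; last first.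
  by exists z; rewrite -hz addrC subrK.
rewrite resD.
have -> : res (2 ^+ n * z) n = ((res (2 ^+ n) n * res z n) %% 2 ^ n)%N by [].
by rewrite res_natX mul0n mod0n addn0 res_mod.
Qed.

Lemma double_eq0 (x : Z2) : 2 * x = 0 -> x = 0.
Proof.
move=> h; apply: Z2_ext => n; rewrite /= mod0n.
have /eqP : res (2%:R * x) n.+1 = 0%N by rewrite h /= mod0n.
rewrite -[res _ _]/((res (2%:R : Z2) n.+1 * res x n.+1) %% 2 ^ n.+1)%N.
rewrite res_natr modnMml expnS -muln_modr muln_eq0 /=.
by rewrite (@res_modle _ _ _ (leqnSn n)) => /eqP.
Qed.

Lemma pow2_inj n : injective (fun x : Z2 => 2 ^+ n * x).
Proof.
move=> x y /eqP; rewrite -subr_eq0 -mulrBr => /eqP h.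
apply/eqP; rewrite -subr_eq0; apply/eqP; elim: n h => [|n IHn].
  by rewrite expr0 mul1r.
by rewrite exprS -mulrA => /double_eq0.
Qed.

Lemma Z2_parity (x : Z2) : (exists z, x = 2 * z) \/ (exists z, x = 1 + 2 * z).
Proof.
have : (res x 1 < 2)%N by rewrite -res_mod ltn_mod.
case e: (res x 1) => [|[|//]] _.
  by left; apply: (@res0_dvd x 1).
right; have /cosetP : Z2_coset 1 1 x by apply/coset_res; rewrite e.
by [].
Qed.

Lemma odd_neq_even (x y : Z2) : 1 + 2 * x <> 2 * y.
Proof.
move=> h.
have /coset_res : Z2_coset (0:Z2) 1 1.
  by apply/cosetP; exists (y - x); rewrite expr1 mulrBr -h; ring.
by rewrite /= mod0n.
Qed.

Lemma pow2_odd_neq n (x y : Z2) : 2 ^+ n * (1 + 2 * x) <> 2 ^+ n.+1 * y.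
Proof. by rewrite exprSr -mulrA => /pow2_inj; apply: odd_neq_even. Qed.

Lemma Z2_factor (x : Z2) : x <> 0 -> exists n y, x = 2 ^+ n * (1 + 2 * y).
Proof.
move=> x0; have [n] : exists n, res x n <> 0%N.
  apply: contrapT => h; apply: x0; apply: Z2_ext => n /=; rewrite mod0n.
  by apply: contrapT => hn; apply: h; exists n.
elim: n x {x0} => [|n IHn] x; first by rewrite res_compat modn1.
case: (Z2_parity x) => [[z ->]|[z ->]]; last first.
  by exists 0%N, z; rewrite expr0 mul1r.
move=> h; have [|m [y ->]] := IHn z; last first.
  by exists m.+1, y; rewrite exprS -mulrA.
move=> z0; apply: h.
rewrite -[LHS]/((res (2%:R : Z2) n.+1 * res z n.+1) %% 2 ^ n.+1)%N.
by rewrite res_natr modnMml expnS -muln_modr -(@res_modle _ _ _ (leqnSn n)) z0.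
Qed.

(** * Balls and closures *)

Lemma nbhs_Z2P (x : Z2) (U : set Z2) :
  nbhs x U <-> exists n, Z2_coset x n `<=` U.
Proof.
rewrite -nbhs_entourageE; split.
  move=> [E [n _ sub] EU]; exists n => y /coset_res xy; apply: EU.
  by rewrite /xsection /= inE; apply: sub; rewrite /= xy.
move=> [n sub]; exists [set xy | res xy.1 n = res xy.2 n]; first by exists n.
by move=> y; rewrite /xsection /= inE /= => xy; apply: sub; apply/coset_res.
Qed.

Lemma closure_Z2P (S : set Z2) (x : Z2) :
  closure S x <-> forall n, exists2 y, S y & Z2_coset x n y.
Proof.
split=> [h n|h U /nbhs_Z2P [n sub]].
  have [|y [Sy xy]] := h (Z2_coset x n); first by apply/nbhs_Z2P; exists n.
  by exists y.
by have [y Sy /sub Uy] := h n; exists y.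
Qed.

Lemma coset_open a n : open (Z2_coset a n).
Proof.
rewrite openE => x /coset_res xa; apply/nbhs_Z2P; exists n => y.
by move=> /coset_res yx; apply/coset_res; rewrite yx.
Qed.

Lemma coset_clopen a n : clopen (Z2_coset a n).
Proof.
split; first exact: coset_open.
move=> x /closure_Z2P/(_ n) [y /coset_res ya /coset_res yx].
by apply/coset_res; rewrite -yx.
Qed.

(** No distance lies strictly between 2^-(n+1) and 2^-n. *)
Lemma ball_coset (R : realType) (a : Z2) n :
  ball a (2%:R ^- n : R) = Z2_coset a n.+1.
Proof.
rewrite Z2_ballE; apply/seteqP; split=> x /=; last first.
  move=> /coset_res/esym/eqP; rewrite -(dist2_le R) => /le_lt_trans; apply.
  by rewrite ltf_pV2 ?posrE ?exprn_gt0 // ltr_eXn2l ?ltr1n.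
move=> h; apply/coset_res/esym/eqP; rewrite -(dist2_le R).
move: h; rewrite /dist2; have [->|[k ->]] := abs2_cases R (a - x).
  by rewrite invr_ge0 exprn_ge0.
by rewrite ltf_pV2 ?lef_pV2 ?posrE ?exprn_gt0 // ltr_eXn2l ?ler_eXn2l ?ltr1n.
Qed.

Lemma coset_union_balls (R : realType) (a b : Z2) n :
  @finite_union_of_balls R Z2 (Z2_coset a n.+1 `|` Z2_coset b n.+1).
Proof.
exists [:: (a, 2%:R ^- n); (b, 2%:R ^- n)].
  by rewrite /= !invr_gt0 !exprn_gt0.
rewrite -!(ball_coset R); apply/seteqP; split=> x /=.
  by case=> h; [exists (a, 2%:R ^- n)|exists (b, 2%:R ^- n)] => //;
    rewrite !inE eqxx ?orbT.
by case=> p; rewrite !inE => /orP[] /eqP ->; [left|right].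
Qed.

(** * Iteration of maps with slope 1 mod 4 *)

(** Division-free form of: the difference quotients of H on A are 1 mod 4. *)
Definition unit_slope (A : set Z2) (H : Z2 -> Z2) :=
  forall x y, A x -> A y -> exists c, H x - H y = (x - y) * (1 + 4 * c).

Definition displaced (r : nat) (A : set Z2) (H : Z2 -> Z2) :=
  forall x, A x -> exists c, H x = x + 2 ^+ r * (1 + 2 * c).

Definition stable (A : set Z2) (H : Z2 -> Z2) := forall x, A x -> A (H x).

(** If H x = x + e then H (H x) - x = (H (H x) - H x) + e = (2 + 4c) e: the
    displacement gains exactly one factor 2. *)
Lemma displaced_square r A H : stable A H -> unit_slope A H ->
  displaced r A H -> displaced r.+1 A (H \o H).
Proof.
move=> sA uA dA x Ax /=; have [c hc] := dA x Ax.
have [e he] := uA _ _ (sA x Ax) Ax.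
exists (c + e + 2 * c * e).
rewrite -[H (H x)](subrK (H x)) he hc exprS; ring.
Qed.

Lemma unit_slope_square A H : stable A H -> unit_slope A H ->
  unit_slope A (H \o H).
Proof.
move=> sA uA x y Ax Ay /=; have [c hc] := uA x y Ax Ay.
have [e he] := uA _ _ (sA x Ax) (sA y Ay).
by exists (c + e + 4 * c * e); rewrite he hc; ring.
Qed.

Lemma stable_iter A H k : stable A H -> stable A (iter k H).
Proof. by move=> sA x Ax; elim: k => //= k; apply: sA. Qed.

Lemma iter_doubleE (T : Type) (H : T -> T) k : iter k.*2 H = iter k H \o iter k H.
Proof. by apply/funext => x; rewrite -addnn iterD. Qed.

Lemma iter_squareE (T : Type) (H : T -> T) k x :
  iter k (H \o H) x = iter k.*2 H x.
Proof. by elim: k => [//|k IHk]; rewrite doubleS !iterS IHk. Qed.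

Lemma unit_slope_iter_pow2 A H j : stable A H -> unit_slope A H ->
  unit_slope A (iter (2 ^ j) H).
Proof.
move=> sA uA; elim: j => [//|j IHj]; rewrite expnS mul2n iter_doubleE.
by apply: unit_slope_square => //; apply: stable_iter.
Qed.

Lemma displaced_iter_pow2 r A H j : stable A H -> unit_slope A H ->
  displaced r A H -> displaced (r + j) A (iter (2 ^ j) H).
Proof.
move=> sA uA dA; elim: j => [|j IHj]; first by rewrite addn0.
rewrite expnS mul2n iter_doubleE addnS; apply: displaced_square => //.
  exact: stable_iter.
exact: unit_slope_iter_pow2.
Qed.

(** The digits of y are matched one at a time: if the digit of weight 2^(r+j) is
    wrong, 2^j more iterations flip it and keep all lower ones. *)
Lemma displaced_dense r A H x y : stable A H -> unit_slope A H ->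
  displaced r A H -> A x -> Z2_coset y r x ->
  forall j, exists i, Z2_coset y (r + j) (iter i H x).
Proof.
move=> sA uA dA Ax xy; elim=> [|j [i /cosetP[z hz]]].
  by exists 0%N; rewrite addn0.
case: (Z2_parity z) => [[w hw]|[w hw]].
  exists i; apply/cosetP; exists w; rewrite hz hw addnS exprSr; ring.
exists (2 ^ j + i)%N; rewrite iterD.
have [c ->] := @displaced_iter_pow2 r A H j sA uA dA _ (@stable_iter A H i sA x Ax).
apply/cosetP; exists (1 + w + c); rewrite hz hw addnS exprSr; ring.
Qed.

(** If N = 2^j (2i+1), then K = H^(2^j) moves points by exactly 2^(r+j), whereas
    the 2i remaining iterations of K move them by multiples of 2^(r+j+1); the
    two displacements cannot cancel. *)
Lemma displaced_aperiodic r A H x N : stable A H -> unit_slope A H ->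
  displaced r A H -> A x -> (0 < N)%N -> iter N H x <> x.
Proof.
move=> sA uA dA Ax N0.
have [i Ni] : exists i, N = (i.*2.+1 * 2 ^ logn 2 N)%N.
  have [m cm Nm] := pfactor_coprime (isT : prime 2) N0.
  move: cm; rewrite coprime2n => om; exists m./2.
  by rewrite {1}Nm -{1}[m]odd_double_half om.
move: (logn 2 N) Ni => j {}/[dup] -> _.
set K := iter (2 ^ j) H.
have -> : iter (i.*2.+1 * 2 ^ j) H x = K (iter i (K \o K) x).
  rewrite iter_squareE -iterS.
  by elim: i.*2.+1 => [//|k IHk]; rewrite mulSn iterD IHk.
have sK : stable A K by exact: stable_iter.
have dK : displaced (r + j) A K by exact: displaced_iter_pow2.
have sKK : stable A (K \o K) by move=> z /sK/sK.
have dKK : displaced (r + j).+1 A (K \o K).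
  by apply: displaced_square => //; exact: unit_slope_iter_pow2.
have [z hz] : exists z, iter i (K \o K) x = x + 2 ^+ (r + j).+1 * z.
  elim: i => [|i [z hz]]; first by exists 0; rewrite mulr0 addr0.
  have [c hc] := dKK _ (@stable_iter A _ i sKK x Ax).
  by exists (z + 1 + 2 * c); rewrite iterS hc hz; ring.
have [c ->] := dK _ (@stable_iter A _ i sKK x Ax).
rewrite hz -addrA -[RHS]addr0 => /addrI h.
have : 2 ^+ (r + j) * (1 + 2 * (c + z)) = 2 ^+ (r + j).+1 * 0.
  by rewrite mulr0 -h exprS; ring.
exact: pow2_odd_neq.
Qed.

(** * The first pair of equal binary digits *)

Lemma binary_digitS q i : binary_digit q i.+1 = binary_digit q./2 i.
Proof. by rewrite /binary_digit expnS divnMA divn2. Qed.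

Lemma binary_digit0 q : binary_digit q 0 = odd q.
Proof. by rewrite /binary_digit divn1 modn2. Qed.

(** The maps q |-> 3q + 2 for even q and q |-> 3q + 1 for odd q are exchanged,
    up to a factor 2, when the last digit of q is dropped and the next digit
    differs from it; the induction follows the alternating digits, and stops at
    valuation 1 when two digits agree. *)
Lemma alternating_digits_valuation t q :
  binary_digit q t = binary_digit q t.+1 ->
  (forall i, (i < t)%N -> binary_digit q i <> binary_digit q i.+1) ->
  exists u, (3 * q + (if odd q then 1 else 2) = 2 ^ t.+1 * u.*2.+1)%N.
Proof.
elim: t q => [|t IHt] q.
  rewrite binary_digitS !binary_digit0 => h _.
  have := odd_double_half q; have := odd_double_half q./2.
  case: (odd q) h; case: (odd q./2) => //= _ h2 h1.
    by exists (3 * (q./2)./2 + 2)%N; lia.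
  by exists (3 * (q./2)./2)%N; lia.
move=> h hlt; have [|i it|u hu] := IHt q./2.
- by rewrite -!binary_digitS.
- by rewrite -!binary_digitS; apply: hlt.
have := hlt 0%N isT; rewrite binary_digitS !binary_digit0 => h0.
exists u; rewrite expnS -mulnA -hu; have := odd_double_half q.
by case: (odd q) h0; case: (odd q./2) => //= _; lia.
Qed.

Lemma first_equal_digits_valuation q : ~~ odd q ->
  exists u, (3 * q + 2 = 2 ^ (first_equal_digits q).+1 * u.*2.+1)%N.
Proof.
rewrite /first_equal_digits => /negPf eq; case: ex_minnP => t /eqP ht tmin.
have [|u] := alternating_digits_valuation t q ht; last by rewrite eq; exists u.
by move=> i it /eqP /tmin; rewrite leqNgt it.
Qed.

(** * Maps close to negation *)

(** What the dynamics depends on: among the even numbers F is close to negation,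
    with s measuring how close; the odd numbers fall into the even ones. *)
Definition almost_negation (s : nat) (F : Z2 -> Z2) :=
  [/\ forall x, F (- x) = - F x,
      forall u v, exists c, F (2 * u) - F (2 * v) = (2 * u - 2 * v) * (-1 + 4 * c),
      forall v, exists c, F (2 * v) = - (2 * v) + 2 * v * (2 ^+ s * (1 + 2 * c)) &
      forall u, exists c, F (1 + 2 * u) = 2 * c].

Lemma fib_almost_negation q : ~~ odd q ->
  almost_negation (first_equal_digits q + 2) (fib (6 + 12 * q)).
Proof.
move=> eq; have [w hw] := first_equal_digits_valuation q eq.
move: (first_equal_digits q) hw => t hw.
have em : (6 + 12 * q = (3 + 6 * q).*2)%N by lia.
split.
- by move=> x; rewrite fib_oppX em -signr_odd /= odd_double expr1 mulN1r.
- move=> u v; have [[c hc] _] := fib_diff_even (3 + 6 * q) u v.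
  have [l hl] : exists l, (4 + 6 * q = 4 * l)%N.
    by exists (1 + 3 * q./2)%N; have := odd_double_half q; rewrite (negPf eq) /=; lia.
  exists (l%:R + c); rewrite em hc; congr (_ * _).
  have -> : (3 + 6 * q)%:R = (4 + 6 * q)%:R - 1 :> Z2.
    by rewrite -[(4 + 6 * q)%N]/((3 + 6 * q).+1) -natr1 addrK.
  by rewrite hl natrM; ring.
- move=> v; have [a ha] := fib_lucas_even (3 * q) v.
  have := @fib_double_addX _ (3 * q).*2.+1 (2 * v); rewrite /= odd_double => /(_ isT).
  have -> : ((3 * q).*2.+3.*2 = 6 + 12 * q)%N by lia.
  have -> : ((3 * q).*2.+4 = 2 ^ t.+2 * w.*2.+1)%N.
    by rewrite expnS -mulnA -hw; lia.
  have [|b ->] := @fib_pow2_index _ t.+1 w.*2.+1 v; first by rewrite /= odd_double.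
  rewrite ha => h; exists (a + b + 2 * a * b).
  by apply: (@addIr _ (2 * v)); rewrite h addn2 !exprS; ring.
- move=> u; have -> : (6 + 12 * q = 3 * (2 + 4 * q))%N by lia.
  by have [] := fib_odd_arg (2 + 4 * q) u.
Qed.

(** The points of 2-adic absolute value 2^-n. *)
Definition sphere (n : nat) : set Z2 := [set x | exists y, x = 2 ^+ n * (1 + 2 * y)].

Lemma sphere_even n x : sphere n.+1 x -> exists u, x = 2 * u.
Proof. by move=> [y ->]; exists (2 ^+ n * (1 + 2 * y)); rewrite exprS mulrA. Qed.

Lemma sphere_inj n m x : sphere n x -> sphere m x -> n = m.
Proof.
have lt_absurd i j z : (i < j)%N -> sphere i z -> sphere j z -> False.
  move=> ij [y ->] [w]; have -> : j = (i.+1 + (j - i.+1))%N by lia.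
  by rewrite exprD -mulrA; apply: pow2_odd_neq.
move=> xn xm; case: (ltngtP n m) => // h; exfalso.
  exact: lt_absurd h xn xm.
exact: lt_absurd h xm xn.
Qed.

Lemma almost_negation_sphere s F n : (0 < s)%N -> almost_negation s F ->
  [/\ stable (sphere n.+1) (fun x => - F x),
      unit_slope (sphere n.+1) (fun x => - F x) &
      displaced (n.+1 + s) (sphere n.+1) (fun x => - F x)].
Proof.
case: s => // s _ [_ slope disp _].
have dF : displaced (n.+1 + s.+1) (sphere n.+1) (fun x => - F x).
  move=> x xn; have [v xv] := sphere_even n x xn.
  have [y hy] := xn; have [c hc] := disp v.
  exists (-1 - y - c - 2 * y * c); rewrite -xv in hc.
  by rewrite hc {2}hy exprD; ring.
split=> // [x xn|x y /sphere_even[u ->] /sphere_even[v ->]].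
  have [c ->] := dF x xn; have [y ->] := xn.
  by exists (y + 2 ^+ s * (1 + 2 * c)); rewrite exprD !exprS; ring.
have [c hc] := slope u v; exists (- c).
by rewrite -opprD hc; ring.
Qed.

(** This is what allows - F, which is close to the identity, to replace F. *)
Lemma almost_negation_square s F : almost_negation s F ->
  (fun x => - F x) \o (fun x => - F x) = F \o F.
Proof. by case=> oddF _ _ _; apply/funext => x /=; rewrite oddF opprK. Qed.

Lemma almost_negation_sphere2 s F n : (0 < s)%N -> almost_negation s F ->
  [/\ stable (sphere n.+1) (F \o F),
      unit_slope (sphere n.+1) (F \o F) &
      displaced (n.+1 + s).+1 (sphere n.+1) (F \o F)].
Proof.
move=> s0 aF; have [sG uG dG] := almost_negation_sphere s F n s0 aF.
rewrite -(almost_negation_square s F aF); split.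
- by move=> x /sG/sG.
- exact: unit_slope_square.
- exact: displaced_square.
Qed.

(** To the precision of the radius of the balls, F acts on a sphere as a
    reflection, independent of the finer structure of F. *)
Lemma almost_negation_reflect s F n x : almost_negation s F -> sphere n.+1 x ->
  Z2_coset (2 ^+ (n.+1 + s) - x) (n.+1 + s).+1 (F x).
Proof.
move=> [_ _ disp _] xn; have [v xv] := sphere_even n x xn.
have [y hy] := xn; have [c hc] := disp v; rewrite -xv in hc.
apply/cosetP; exists (y + c + 2 * y * c).
by rewrite hc {2}hy -addnS !exprD !exprS; ring.
Qed.

(** * The components *)

(** Dividing by 2^n, a point of the component is 1 mod 4 in its first ball and
    3 mod 4 in its second one, and k is
    given by the next t + 1 digits, read after a reflection in the latter case. *)
Lemma fib_componentP t n k x : fib_component t n k x <->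
  exists z, x = 2 ^+ n * (1 + 4 * (k%:R + 2 ^+ t.+1 * z)) \/
            x = 2 ^+ n * (2 ^+ t.+2 - (1 + 4 * (k%:R + 2 ^+ t.+1 * z))).
Proof.
have e z : 2 ^+ (n + t + 3) * z = 2 ^+ n * (4 * (2 ^+ t.+1 * z)) :> Z2.
  by rewrite -addnA addn3 exprD !exprS; ring.
rewrite /fib_component addn2; split.
  case=> /cosetP [z ->]; [exists z; left|exists (- z); right].
    by rewrite e; ring.
  by rewrite e; ring.
move=> [z [->|->]]; [left|right]; apply/cosetP.
  by exists z; rewrite e; ring.
by exists (- z); rewrite e; ring.
Qed.

Lemma fib_component_sphere t n k x : fib_component t n k x -> sphere n x.
Proof.
move=> /fib_componentP[z [->|->]].
  by exists (2 * (k%:R + 2 ^+ t.+1 * z)); ring.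
exists (2 ^+ t.+1 - 1 - 2 * (k%:R + 2 ^+ t.+1 * z)).
by rewrite !exprS; ring.
Qed.

(** An odd number is 1 mod 4, or becomes so after the reflection y |-> 2^s - y
    that exchanges the two balls. *)
Lemma sphere_fib_component t n x : sphere n x ->
  exists2 k, (k < 2 ^ (t + 1))%N & fib_component t n k x.
Proof.
move=> [y ->].
have [w hw] : exists w, 1 + 2 * y = 1 + 4 * w \/ 1 + 2 * y = 2 ^+ t.+2 - (1 + 4 * w).
  case: (Z2_parity y) => [[w ->]|[w ->]]; first by exists w; left; ring.
  by exists (2 ^+ t - 1 - w); right; rewrite !exprS; ring.
exists (res w (t + 1)); first by rewrite -res_mod ltn_mod expn_gt0.
have /cosetP[z wz] : Z2_coset (res w (t + 1))%:R t.+1 w.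
  by apply/coset_res; rewrite res_natr addn1 res_mod.
apply/fib_componentP; exists z; rewrite -wz.
by case: hw => ->; [left|right].
Qed.

Lemma fib_component_inj t n m k l x : (k < 2 ^ (t + 1))%N -> (l < 2 ^ (t + 1))%N ->
  fib_component t n k x -> fib_component t m l x -> (n, k) = (m, l).
Proof.
rewrite !addn1 => kt lt xk xl.
have nm : n = m.
  apply: (@sphere_inj _ _ x).
    exact: fib_component_sphere xk.
  exact: fib_component_sphere xl.
subst m; congr pair.
have cancel4 (z w : Z2) :
    4 * (k%:R + 2 ^+ t.+1 * z) = 4 * (l%:R + 2 ^+ t.+1 * w) -> k = l.
  have e4 y : 4 * y = 2 ^+ 2 * y :> Z2 by ring.
  rewrite !e4 => /pow2_inj h.
  have /coset_res : Z2_coset (k%:R) t.+1 (k%:R + 2 ^+ t.+1 * z).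
    by apply/cosetP; exists z.
  have /coset_res : Z2_coset (l%:R) t.+1 (l%:R + 2 ^+ t.+1 * w).
    by apply/cosetP; exists w.
  by rewrite h => ->; rewrite !res_natr !modn_small.
have mixed (a b : Z2) : 1 + 4 * a <> 2 ^+ t.+2 - (1 + 4 * b).
  move=> h; apply: (@odd_neq_even (a + b) (2 ^+ t)); apply: (@pow2_inj 1) => /=.
  transitivity (1 + 4 * a + (1 + 4 * b)); first by ring.
  by rewrite h !exprS; ring.
move: xk xl => /fib_componentP[z [->|->]] /fib_componentP[w [|]] /pow2_inj h.
- by apply: (cancel4 z w); move/addrI: h.
- by case: (mixed _ _ h).
- by case: (mixed _ _ (esym h)).
- by apply: (cancel4 z w); move/addrI/oppr_inj/addrI: h.
Qed.

Lemma coset_reflect c a n x : Z2_coset a n x -> Z2_coset (c - a) n (c - x).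
Proof. by move=> /cosetP[z ->]; apply/cosetP; exists (- z); ring. Qed.

(** The two balls of a component are the ball of any of its points and the
    mirror image of that ball. *)
Lemma fib_component_reflect t n k x y :
  fib_component t n k x ->
  fib_component t n k y <->
  Z2_coset x (n + t + 3) y \/ Z2_coset (2 ^+ (n + (t + 2)) - x) (n + t + 3) y.
Proof.
have -> : fib_component t n k =
    Z2_coset ((1 + 4%:R * k%:R) * 2%:R ^+ n) (n + t + 3) `|`
    Z2_coset (2 ^+ (n + (t + 2)) - (1 + 4%:R * k%:R) * 2%:R ^+ n) (n + t + 3).
  by rewrite /fib_component; congr (_ `|` Z2_coset _ _); rewrite [in RHS]exprD; ring.
move: (_ * 2%:R ^+ n) => a; set c := 2 ^+ _; set N := (n + t + 3)%N.
have cK z : c - (c - z) = z by rewrite opprB addrC subrK.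
case=> xa; have xa' := @coset_reflect c _ _ _ xa; rewrite ?cK in xa'.
  by move: xa xa' => /coset_res xa /coset_res xa'; split; case=> /coset_res y';
    [left|right|left|right]; apply/coset_res; rewrite y' ?xa ?xa'.
by move: xa xa' => /coset_res xa /coset_res xa'; split; case=> /coset_res y';
    [right|left|right|left]; apply/coset_res; rewrite y' ?xa ?xa'.
Qed.

Lemma fib_component_stable t n k F : almost_negation (t + 2) F ->
  stable (fib_component t n.+1 k) F.
Proof.
move=> aF x xM; apply/(fib_component_reflect _ _ _ _ _ xM); right.
have := almost_negation_reflect _ _ n x aF (fib_component_sphere _ _ _ _ xM).
by have -> : ((n.+1 + (t + 2)).+1 = n.+1 + t + 3)%N by lia.
Qed.

(** If y is not in the ball of x then it is in that of F x; in both cases the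
    orbit under F o F, on which F o F displaces by exactly the radius of the
    ball, comes arbitrarily close to y. *)
Lemma fib_component_minimal {R : realType} t n k F :
  almost_negation (t + 2) F ->
  @minimal_on R Z2 F (fib_component t n.+1 k).
Proof.
move=> aF x xM y yM; apply/closure_Z2P => j.
have [sH uH dH] := almost_negation_sphere2 (t + 2) F n ltac:(lia) aF.
have eN : ((n.+1 + (t + 2)).+1 = n.+1 + t + 3)%N by lia.
have [l [xl ylx]] : exists l, sphere n.+1 (iter l F x) /\
    Z2_coset y (n.+1 + t + 3) (iter l F x).
  have xS := fib_component_sphere _ _ _ _ xM.
  have /(fib_component_reflect _ _ _ _ _ xM) := yM.
  case=> /coset_res yx.
    by exists 0%N; split=> //; apply/coset_res; rewrite yx.
  have := fib_component_stable _ n k F aF x xM => FM.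
  exists 1%N; split; first exact: fib_component_sphere FM.
  have := almost_negation_reflect _ _ n x aF xS; rewrite eN => /coset_res Fx.
  by apply/coset_res; rewrite yx.
rewrite -eN in ylx.
have [i /coset_res hi] := displaced_dense _ _ _ _ y sH uH dH xl ylx j.
exists (iter (i.*2 + l) F x); first by exists (i.*2 + l)%N.
apply/coset_res; apply: (@res_le_eq _ _ j _ (leq_addl _ j)).
rewrite iterD -iter_squareE; exact: hi.
Qed.

Lemma fib_component_minimal_component {R : realType} t n k F :
  almost_negation (t + 2) F ->
  @minimal_component R Z2 F (fib_component t n.+1 k).
Proof.
move=> aF; split.
- by exists ((1 + 4%:R * k%:R) * 2%:R ^+ n.+1); left; exists 0; rewrite ?mulr0 ?addr0.
- have [op1 cl1] := coset_clopen ((1 + 4%:R * k%:R) * 2%:R ^+ n.+1) (n.+1 + t + 3).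
  have [op2 cl2] := coset_clopen
    ((2%:R ^+ (t + 2) - 1 - 4%:R * k%:R) * 2%:R ^+ n.+1) (n.+1 + t + 3).
  by split; [exact: openU|exact: closedU].
- by rewrite /fib_component addn3; apply: coset_union_balls.
- by move=> _ [x xM <-]; apply: (fib_component_stable _ n k F aF).
- exact: fib_component_minimal.
Qed.

(** Both sets are the closure of the orbit of x. *)
Lemma minimal_component_eq {R : realType} (F : Z2 -> Z2) C C' x :
  @minimal_component R Z2 F C ->
  @minimal_component R Z2 F C' -> C x -> C' x -> C = C'.
Proof.
have sub D D' : @minimal_component R Z2 F D -> @minimal_component R Z2 F D' ->
    D x -> D' x -> D `<=` D'.
  move=> [_ _ _ _ mD] [_ [_ cD'] _ sD' _] Dx D'x.
  apply: (subset_trans (mD x Dx)); rewrite [X in _ `<=` X](closure_id D').1 //.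
  apply: closure_subset => _ [l _ <-]; elim: l => [//|l IHl].
  by apply: sD'; exists (iter l F x).
by move=> mC mC' Cx C'x; apply/seteqP; split; apply: sub.
Qed.

Lemma attracting_basin_one_step {R : realType} (F : Z2 -> Z2) C x :
  stable C F -> C (F x) ->
  @attracting_basin R Z2 F C x.
Proof.
move=> sC CFx; rewrite /attracting_basin /=.
apply: cvg_near_cst; near=> l.
have l0 : (0 < l)%N by near: l; exists 1%N.
by apply: edist_inf0; rewrite -(prednK l0) iterSr; apply: stable_iter.
Unshelve. all: by end_near. Qed.

Lemma even_zero_or_component t u : 2 * u = 0 \/
  exists nk : nat * nat, ((1 <= nk.1)%N /\ (nk.2 < 2 ^ (t + 1))%N) /\
     fib_component t nk.1 nk.2 (2 * u).
Proof.
have [->|u0] := pselect (u = 0); first by left; rewrite mulr0.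
right; have [n [y uy]] := Z2_factor u u0.
have [|k kt uM] := sphere_fib_component t n.+1 (2 * u).
  by exists y; rewrite uy exprS mulrA.
by exists (n.+1, k).
Qed.

Lemma almost_negation_iter_even s F u l : almost_negation s F ->
  exists v, iter l F (2 * u) = 2 * v.
Proof.
move=> [_ _ disp _]; elim: l => [|l [v hv]]; first by exists u.
have [c] := disp v; rewrite iterS hv => ->.
by exists (- v + v * (2 ^+ s * (1 + 2 * c))); ring.
Qed.

Theorem theorem7p7 (R : realType) (d q m t : nat)
  (hq : q = (2 + 4 * d)%N) (hm : m = (6 + 12 * q)%N)
  (ht : t = first_equal_digits q) :
  let F : Z2 -> Z2 := fun x => (fibonacci_poly Z2 m).[x] in
  let D : set (nat * nat) := [set nk | (1 <= nk.1)%N /\ (nk.2 < 2 ^ (t + 1))%N] in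
  let M : nat * nat -> set Z2 := fun nk => fib_component t nk.1 nk.2 in
  let B : set Z2 := [set 1 + 2%:R * z | z in [set: Z2]] in
  [/\ @minimal_decomposition R Z2 F [set 0] (nat * nat)%type D M B,
      F 0 = 0,
      clopen B &
      forall x, B x ->
        @attracting_basin R Z2 F [set 0] x \/
        (exists2 nk, D nk & @attracting_basin R Z2 F (M nk) x)].
Proof.
move=> F D M B.
have aF : almost_negation (t + 2) F.
  have -> : F = fib (6 + 12 * q) by rewrite /F hm.
  by rewrite ht; apply: fib_almost_negation; rewrite hq oddD oddM.
have [_ _ disp oddF] := aF.
have F0 : F 0 = 0.
  by have [c] := disp 0; rewrite mulr0 => ->; rewrite mul0r oppr0 addr0.
have Meven nk x : D nk -> M nk x -> exists u, x = 2 * u.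
  by case: nk => -[|n] k [] //= _ _ /fib_component_sphere/sphere_even.
have Mneq0 nk : ~ M nk 0.
  move=> /fib_component_sphere [y]; rewrite -(mulr0 (2 ^+ nk.1.+1)) => /esym.
  exact: pow2_odd_neq.
have Bodd x : B x <-> exists u, x = 1 + 2 * u.
  by split=> [[u _ <-]|[u ->]]; exists u.
have Mmin nk : D nk -> @minimal_component R Z2 F (M nk).
  by case: nk => -[|n] k [] //= _ _; apply: fib_component_minimal_component.
have Mstable nk : D nk -> stable (M nk) F.
  by move=> /Mmin[_ _ _ sM _] x Mx; apply: sM; exists x.
have basin x : B x -> @attracting_basin R Z2 F [set 0] x \/
    (exists2 nk, D nk & @attracting_basin R Z2 F (M nk) x).
  move=> /Bodd[u ->]; have [c Fc] := oddF u.
  case: (even_zero_or_component t c) => [c0|[nk [Dnk Mc]]]; [left|right; exists nk => //].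
    by apply: attracting_basin_one_step => [_ ->|]; rewrite /= ?Fc.
  by apply: attracting_basin_one_step; [exact: Mstable|rewrite Fc].
have clB : clopen B.
  have -> : B = Z2_coset 1 1 by [].
  exact: coset_clopen.
split=> //; split; last first.
- move=> x /basin[h|h]; [left; exists 0 => //|by right].
  suff -> : @Defs.orbit R Z2 F 0 = [set 0] by [].
  apply/seteqP; split=> [_ [n _ <-]|_ ->]; last by exists 0%N.
  by elim: n => [//|n IHn] /=; rewrite IHn.
- split.
  + exact: countableP.
  + move=> [n k] [n' l] [_ kt] [_ lt] [x [xk xl]].
    exact: fib_component_inj kt lt xk xl.
  + apply/seteqP; split=> [_ [nk Dnk <-]|C Cmin]; first exact: Mmin.
    have [[x Cx] [opC clC] _ sC mC] := Cmin.
    have Ceven u : C (2 * u) -> exists2 nk, D nk & M nk = C.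
      case: (even_zero_or_component t u) => [->|[nk [Dnk Mu]]] Cu; last first.
        exists nk => //.
        exact: minimal_component_eq (Mmin nk Dnk) Cmin Mu Cu.
      (* Near 0 the set C contains powers of 2, but the orbit of 0 is {0}. *)
      exfalso; have /nbhs_Z2P[n sub] : nbhs (0 : Z2) C by exact: open_nbhs_nbhs.
      have Cpow : C (2 ^+ n).
        by apply: sub; apply/cosetP; exists 1; rewrite mulr1 add0r.
      have /closure_Z2P/(_ n.+1) [_ [i _ <-]] := mC 0 Cu _ Cpow.
      have -> : iter i F 0 = 0 by elim: i => [//|i IHi]; rewrite iterS IHi.
      move=> /cosetP[z h]; apply: (@pow2_odd_neq n 0 (- z)).
      rewrite mulrN; apply/eqP; rewrite -addr_eq0; apply/eqP.
      by rewrite [RHS]h; ring.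
    case: (Z2_parity x) => [[u xu]|[u xu]]; first by apply: (Ceven u); rewrite -xu.
    (* The orbit of F x stays even, hence away from the odd point x. *)
    exfalso; have [c Fc] := oddF u.
    have CF : C (2 * c) by rewrite -Fc -xu; apply: sC; exists x.
    have /closure_Z2P/(_ 1) [_ [i _ <-]] := mC _ CF _ Cx.
    have [v ->] := almost_negation_iter_even _ _ c i aF.
    move=> /cosetP[z]; rewrite xu expr1 => h.
    by apply: (@odd_neq_even (u + z) v); rewrite h; ring.
- split; first exact: finite_set1.
  apply/seteqP; split=> [_ ->|x [N N0 xN]]; first by exists 1%N.
  case: (Z2_parity x) => [[u xu]|[u xu]]; last first.
    exfalso; case: N N0 xN => // N _; rewrite iterSr xu; have [c ->] := oddF u.
    have [v ->] := almost_negation_iter_even _ _ c N aF.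
    by move/esym; apply: odd_neq_even.
  apply: contrapT => x0.
  have [n [y xy]] : exists n, sphere n.+1 x.
    have [u0|n [y uy]] := @Z2_factor u.
      by apply: x0; rewrite /= xu u0 mulr0.
    by exists n, y; rewrite xu uy exprS mulrA.
  have [sH uH dH] := almost_negation_sphere2 (t + 2) F n ltac:(lia) aF.
  apply: (displaced_aperiodic _ _ _ x N sH uH dH _ N0); first by exists y.
  by rewrite iter_squareE iter_doubleE /= xN xN.
- split.
  + apply/seteqP; split=> // x _.
    case: (Z2_parity x) => [[u ->]|[u ->]]; last by right; exists u.
    left; case: (even_zero_or_component t u) => [->|[nk [Dnk Mu]]]; [by left|right].
    by exists nk.
  + by rewrite -subset0 => x [-> [nk _ /Mneq0]].
  + rewrite -subset0 => x [-> /Bodd[u]]; rewrite -(mulr0 2) => /esym.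
    exact: odd_neq_even.
  + rewrite -subset0 => x [[nk Dnk /(Meven _ _ Dnk)[u ->]] /Bodd[v /esym]].
    exact: odd_neq_even.
Qed.
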